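(* Let $(G,J)$ be a $2n$-dimensional Lie group equipped with a left invariant complex structure. If $K_{(G,J)}^{\otimes k}$ admits a nonzero invariant holomorphic section for some $k\in\mathbb{N}$ ($k\ge 1$), then $K_{(G,J)}$ admits a nonzero invariant holomorphic section; that is, $(G,J)$ has trivial canonical bundle (trivialized by an invariant section). The same happens for any quotient $\Gamma\backslash G$ where $\Gamma$ is a uniform lattice of $G$: if $K_{(\Gamma\backslash G,J)}^{\otimes k}$ admits a nonzero invariant holomorphic section for some $k\ge 1$, then $K_{(\Gamma\backslash G,J)}$ admits a nonzero invariant holomorphic section.
   Context: For a complex manifold $M$ of complex dimension $n$, $K_M=\bigwedge^n\mathcal{T}^*_M$ is its canonical bundle ($\mathcal{T}^*_M$ the holomorphic cotangent bundle) and $K_M^{\otimes k}$ its $k$-th tensor power, with the induced holomorphic structure. ''Trivial'' means holomorphically trivial. A left invariant complex structure on $G$ is one for which left translations are holomorphic; it induces a complex structure, still denoted $J$, on $\Gamma\backslash G$. A uniform lattice is a discrete subgroup $\Gamma$ with $\Gamma\backslash G$ compact. A section of $K_{(G,J)}^{\otimes k}$ is called invariant if it is invariant under left translations of $G$ (so it is determined by an element of $(\bigwedge^{n,0}\mathfrak{g}^* )^{\otimes k}$, $\mathfrak{g}=\operatorname{Lie}(G)$); a section of $K_{(\Gamma\backslash G,J)}^{\otimes k}$ is called invariant if it is induced by a left invariant section of $K_{(G,J)}^{\otimes k}$. *)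

(* Defs.v *)
From HB Require Import structures.
From mathcomp Require Import all_boot all_order all_algebra.
From mathcomp Require Import all_classical all_reals all_analysis.
From mathcomp Require Import complex.

Set Implicit Arguments.
Unset Strict Implicit.
Unset Printing Implicit Defensive.

Import Order.TTheory GRing.Theory Num.Theory.
Import numFieldNormedType.Exports.

Local Open Scope ring_scope.
Local Open Scope complex_scope.
Local Open Scope classical_set_scope.

(* Both maps are total functions: cmap is meaningful on cdom only, and cinv,
   the inverse of cmap, on cmap @` cdom only. *)
Record chart (M E : Type) := Chart {
  cdom : set M ;
  cmap : M -> E ;
  cinv : E -> M }.

Definition is_chart (M E : topologicalType) (c : chart M E) : Prop :=
  [/\ open (cdom c), open (cmap c @` cdom c),
      forall x, cdom c x -> cinv c (cmap c x) = x,
      {within cdom c, continuous (cmap c)} &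
      {within cmap c @` cdom c, continuous (cinv c)}].

Definition charted (M E : topologicalType) (A : set (chart M E)) : Prop :=
  (forall c, A c -> is_chart c) /\ (forall x, exists2 c, A c & cdom c x).

Definition local_rep (M N E E' : Type) (c : chart M E) (d : chart N E')
  (F : M -> N) : E -> E' := cmap d \o F \o cinv c.

Definition local_dom (M N E E' : Type) (c : chart M E) (d : chart N E')
  (F : M -> N) : set E := cmap c @` (cdom c `&` F @^-1` cdom d).

Definition prod_chart (M N E E' : Type) (c : chart M E) (d : chart N E') :
    chart (M * N) (E * E') :=
  Chart (cdom c `*` cdom d)
        (fun x => (cmap c x.1, cmap d x.2))
        (fun u => (cinv c u.1, cinv d u.2)).

Definition prod_atlas (M N E E' : Type) (A : set (chart M E))
    (B : set (chart N E')) : set (chart (M * N) (E * E')) :=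
  [set prod_chart c d | c in A & d in B].

(* In finite dimension, f is of class C^(k+1) on the open set U iff it is
   differentiable on U with all its directional derivatives of class C^k. *)
Fixpoint Ck_on (R : realType) (V W : normedModType R) (k : nat) (U : set V)
    (f : V -> W) : Prop :=
  match k with
  | 0 => forall u, U u -> {for u, continuous f}
  | k'.+1 => (forall u, U u -> differentiable f u) /\
             (forall v, Ck_on k' U (fun u => 'D_v f u))
  end.

Definition smooth_on (R : realType) (V W : normedModType R) (U : set V)
  (f : V -> W) : Prop := forall k, Ck_on k U f.

Definition smooth_map (R : realType) (M N : topologicalType)
    (V W : normedModType R) (A : set (chart M V)) (B : set (chart N W))
    (F : M -> N) : Prop :=
  continuous F /\
  forall c d, A c -> B d -> smooth_on (local_dom c d F) (local_rep c d F).

Definition smooth_atlas (R : realType) (M : topologicalType)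
    (V : normedModType R) (S : set (chart M V)) : Prop :=
  charted S /\ smooth_map S S id.

(* No compatibility between the group law and the topology is built in here:
   it comes with lie_group. *)
#[short(type="topGroupType")]
HB.structure Definition TopGroup := {G of Group G & Topological G}.

Definition lie_group (R : realType) (m : nat) (G : topGroupType)
    (S : set (chart G 'rV[R]_m)) : Prop :=
  [/\ hausdorff_space G, @second_countable G, smooth_atlas S,
      smooth_map (prod_atlas S S) S (fun x : G * G => (x.1 * x.2)%g) &
      smooth_map S S (fun x : G => (x^-1)%g)].

(* V and W are normed spaces over R[i], so the differentials are C-linear; the
   sets U below are open. *)
Definition holomorphic_on (R : realType) (V W : normedModType R[i])
    (U : set V) (f : V -> W) : Prop :=
  forall u, U u -> differentiable f u.

Definition holomorphic_map (R : realType) (M N : topologicalType)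
    (V W : normedModType R[i]) (A : set (chart M V)) (B : set (chart N W))
    (F : M -> N) : Prop :=
  continuous F /\
  forall c d, A c -> B d -> holomorphic_on (local_dom c d F) (local_rep c d F).

Definition complex_atlas (R : realType) (M : topologicalType)
    (V : normedModType R[i]) (A : set (chart M V)) : Prop :=
  charted A /\ holomorphic_map A A id.

Definition realify (R : realType) (n : nat) (z : 'rV[R[i]]_n) :
    'rV[R]_(n + n) :=
  row_mx (map_mx (@complex.Re R) z) (map_mx (@complex.Im R) z).

Definition complexify (R : realType) (n : nat) (u : 'rV[R]_(n + n)) :
    'rV[R[i]]_n :=
  \row_j (lsubmx u 0 j +i* rsubmx u 0 j).

Definition real_chart (R : realType) (n : nat) (M : Type)
    (c : chart M 'rV[R[i]]_n) : chart M 'rV[R]_(n + n) :=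
  Chart (cdom c) (@realify R n \o cmap c) (cinv c \o @complexify R n).

(* A is a complex structure on the smooth manifold (M, S): its charts, read in
   R^(2n), are smoothly compatible with S. *)
Definition complex_structure (R : realType) (n : nat) (M : topologicalType)
    (S : set (chart M 'rV[R]_(n + n))) (A : set (chart M 'rV[R[i]]_n)) : Prop :=
  complex_atlas A /\ smooth_atlas (S `|` @real_chart R n M @` A).

Definition left_invariant_structure (R : realType) (n : nat) (G : topGroupType)
    (A : set (chart G 'rV[R[i]]_n)) : Prop :=
  forall g : G, holomorphic_map A A (fun x => (g * x)%g).

(* The k-th tensor power of Lambda^n (C^n)^* is realized as the space of
   scalar functions of k blocks of n vectors of C^n (the rows of the matrices
   B i) that are linear in each vector and alternating in each block. *)
Definition blocks (R : realType) (n k : nat) : Type := 'I_k -> 'M[R[i]]_n.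

Definition set_vector (R : realType) (n k : nat) (B : blocks R n k)
    (i : 'I_k) (r : 'I_n) (v : 'rV[R[i]]_n) : blocks R n k :=
  fun j => \matrix_(a, b) if (j == i) && (a == r) then v 0 b else B j a b.

Definition pluriform (R : realType) (n k : nat) (w : blocks R n k -> R[i]) :
    Prop :=
  (forall B i r (a : R[i]) u v,
     w (set_vector B i r (a *: u + v)) =
     a * w (set_vector B i r u) + w (set_vector B i r v)) /\
  (forall B i r s, r != s -> row r (B i) = row s (B i) -> w B = 0).

(* The pullback of w by the linear map v |-> v *m J. *)
Definition pull_form (R : realType) (n k : nat)
    (J : 'M[R[i]]_n) (w : blocks R n k -> R[i]) : blocks R n k -> R[i] :=
  fun B => w (fun i => B i *m J).

(* A section is given by its components in the charts: s c x is its value at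
   x, read on C^n through the chart c; it is meaningful for cdom c x only. *)
Definition sections (R : realType) (n k : nat) (M : Type) : Type :=
  chart M 'rV[R[i]]_n -> M -> blocks R n k -> R[i].

(* F^* t = s; by the library's convention, 'J f p acts on row vectors on the
   right, so that v *m 'J f p is the differential of f at p applied to v. *)
Definition pullback_eq (R : realType) (n k : nat) (M N : Type)
    (A : set (chart M 'rV[R[i]]_n)) (B : set (chart N 'rV[R[i]]_n))
    (F : M -> N) (t : sections R n k N) (s : sections R n k M) : Prop :=
  forall c d x, A c -> B d -> cdom c x -> cdom d (F x) ->
    s c x = pull_form ('J (local_rep c d F) (cmap c x)) (t d (F x)).

Definition is_section (R : realType) (n k : nat) (M : Type)
    (A : set (chart M 'rV[R[i]]_n)) (s : sections R n k M) : Prop :=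
  (forall c x, A c -> cdom c x -> pluriform (s c x)) /\
  pullback_eq A A id s s.

Definition holomorphic_section (R : realType) (n k : nat) (M : Type)
    (A : set (chart M 'rV[R[i]]_n)) (s : sections R n k M) : Prop :=
  is_section A s /\
  forall c B, A c ->
    holomorphic_on (cmap c @` cdom c)
      (fun u : 'rV[R[i]]_n => s c (cinv c u) B : R[i]^o).

Definition nonzero_section (R : realType) (n k : nat) (M : Type)
    (A : set (chart M 'rV[R[i]]_n)) (s : sections R n k M) : Prop :=
  exists c x B, [/\ A c, cdom c x & s c x B != 0].

(* The value of s at each point is a basis of the fibre; a holomorphic section
   with this property trivializes the bundle. *)
Definition frame (R : realType) (n k : nat) (M : Type)
    (A : set (chart M 'rV[R[i]]_n)) (s : sections R n k M) : Prop :=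
  forall c x, A c -> cdom c x ->
  forall w : blocks R n k -> R[i], pluriform w ->
  exists! a : R[i], w = (fun B => a * s c x B).

Definition left_invariant_section (R : realType) (n k : nat)
    (G : topGroupType) (A : set (chart G 'rV[R[i]]_n)) (s : sections R n k G) :
    Prop :=
  forall g : G, pullback_eq A A (fun x => (g * x)%g) s s.

Section LeftQuotient.
Variables (G : topGroupType) (Gam : groupClosed G).

Definition same_orbit : rel G := fun x y => (y * x^-1)%g \in Gam.

Lemma same_orbit_refl : reflexive same_orbit.
Proof. by move=> x; rewrite /same_orbit mulgV gpred1. Qed.

Lemma same_orbit_sym : symmetric same_orbit.
Proof. by move=> x y; exact: gpredFC. Qed.

Lemma same_orbit_trans : transitive same_orbit.
Proof.
move=> y x z xy yz; rewrite /same_orbit.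
have -> : (z * x^-1 = (z * y^-1) * (y * x^-1))%g by rewrite mulgA mulgVK.
exact: gpredM.
Qed.

Definition same_orbit_equiv : equiv_rel G :=
  EquivRel same_orbit same_orbit_refl same_orbit_sym same_orbit_trans.

Definition left_quotient : Type :=
  quotient_topology {eq_quot same_orbit_equiv}%qT.

HB.instance Definition _ := Topological.copy left_quotient
  (quotient_topology {eq_quot same_orbit_equiv}%qT).

Definition to_quotient : G -> left_quotient :=
  (\pi_{eq_quot same_orbit_equiv})%qT.

(* The induced complex structure: the charts of G, restricted to open sets on
   which the projection is injective, and transported by the projection. *)
Definition quotient_atlas (R : realType) (n : nat)
    (A : set (chart G 'rV[R[i]]_n)) : set (chart left_quotient 'rV[R[i]]_n) :=
  [set q | exists c, exists V : set G,
     [/\ A c, open V, V `<=` cdom c &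
         forall x y, V x -> V y -> to_quotient x = to_quotient y -> x = y] /\
     [/\ cdom q = to_quotient @` V,
         forall x, V x -> cmap q (to_quotient x) = cmap c x &
         forall x, V x -> cinv q (cmap c x) = to_quotient x]].

Definition uniform_lattice : Prop :=
  [set` Gam] `<=` isolated [set` Gam] /\ compact [set: left_quotient].

Definition induced_invariant_section (R : realType) (n k : nat)
    (A : set (chart G 'rV[R[i]]_n)) (t : sections R n k left_quotient) : Prop :=
  exists s : sections R n k G,
    [/\ is_section A s, left_invariant_section A s &
        pullback_eq A (quotient_atlas A) to_quotient t s].

End LeftQuotient.

(* Main.v *)
(* Fix a chart c0 at the identity. In a chart c, the left invariant section of
   the canonical bundle that is the standard volume form of c0 at the identity
   is h_c(x) det, where h_c(x) is the determinant of the differential at x, read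
   in the charts c and c0, of the left translation by x^-1; it is nowhere zero.
   An invariant section of the k-th power has the component h_c^k times a
   constant, so h_c^k is holomorphic as soon as a nonzero invariant holomorphic
   section of the k-th power exists. Since the group law is of class C^1, h_c is
   continuous, and a continuous nonvanishing function with a holomorphic k-th
   power is holomorphic. On the quotient, an invariant section lifts to the
   group, and the section produced there descends, because the charts of the
   quotient turn the projection and the changes of charts into left
   translations. *)

Require Import Defs.
From HB Require Import structures.
From mathcomp Require Import all_boot all_order all_algebra.
From mathcomp Require Import perm.
From mathcomp Require Import all_classical all_reals all_analysis.
From mathcomp Require Import complex.

Set Implicit Arguments.
Unset Strict Implicit.
Unset Printing Implicit Defensive.

Import Order.TTheory GRing.Theory Num.Theory.
Import numFieldNormedType.Exports.

Local Open Scope ring_scope.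
Local Open Scope complex_scope.
Local Open Scope classical_set_scope.

(** * Alternating forms on square matrices *)

Definition set_row (C : Type) (n : nat) (M : 'M[C]_n) (r : 'I_n)
    (v : 'rV[C]_n) : 'M[C]_n :=
  \matrix_(a, b) if a == r then v 0 b else M a b.

Definition alternating_form (C : comPzRingType) (n : nat) (f : 'M[C]_n -> C) :=
  (forall M r a u v, f (set_row M r (a *: u + v)) =
     a * f (set_row M r u) + f (set_row M r v)) /\
  (forall M r s, r != s -> row r M = row s M -> f M = 0).

Section AlternatingForm.
Variables (C : comPzRingType) (n : nat).
Implicit Types (f : 'M[C]_n -> C) (M : 'M[C]_n).

Lemma row_set_row M r v : row r (set_row M r v) = v.
Proof. by apply/rowP => j; rewrite !mxE eqxx. Qed.

Lemma row_set_row_neq M r s v : s != r -> row s (set_row M r v) = row s M.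
Proof. by move=> sr; apply/rowP => j; rewrite !mxE (negbTE sr). Qed.

Lemma set_row_id M r : set_row M r (row r M) = M.
Proof. by apply/matrixP => a b; rewrite !mxE; case: eqP => // ->. Qed.

Lemma alternating_det : alternating_form (@determinant C n).
Proof.
split=> [M r a u v|M r s rs /rowP e].
  rewrite -[\det (set_row M r v)]mul1r.
  apply: (@determinant_multilinear _ _ _ _ _ r).
  - by rewrite !row_set_row scale1r.
  - by apply/matrixP => i j; rewrite !mxE eq_sym (negbTE (neq_lift _ _)).
  - by apply/matrixP => i j; rewrite !mxE eq_sym (negbTE (neq_lift _ _)).
by apply: (determinant_alternate rs) => j; have := e j; rewrite !mxE.
Qed.

Lemma alternating_formB f g c : alternating_form f -> alternating_form g ->
  alternating_form (fun M => f M - g M * c).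
Proof.
move=> [f1 f2] [g1 g2]; split=> [M r a u v|M r s rs e]; last first.
  by rewrite (f2 _ _ _ rs e) (g2 _ _ _ rs e) mul0r subrr.
by rewrite f1 g1 mulrDl mulrBr opprD addrACA mulrA.
Qed.

(** Polarization: [f] vanishes when rows [i] and [j] both equal the sum of these two rows of [M];
    expanding leaves [f M] plus the value at the swapped matrix. *)
Lemma alternating_xrow f M i j : alternating_form f -> i != j ->
  f (xrow i j M) = - f M.
Proof.
move=> [f1 f2] ij; have ji : j != i by rewrite eq_sym.
have f1' N r u v : f (set_row N r (u + v)) =
    f (set_row N r u) + f (set_row N r v).
  by rewrite -{1}[u]scale1r f1 mul1r.
pose S u v := set_row (set_row M i u) j v.
have SC u v : S u v = set_row (set_row M j v) i u.
  apply/matrixP => a b; rewrite !mxE.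
  by have [->|//] := eqVneq a j; rewrite (negbTE ji).
have S0 u : f (S u u) = 0.
  by apply: (f2 _ _ _ ij); rewrite /S row_set_row row_set_row_neq// row_set_row.
have := S0 (row i M + row j M).
rewrite /S f1' -/(S _ _) -/(S _ _) 2!{1}SC !f1' -!SC !S0 add0r addr0.
have -> : S (row i M) (row j M) = M.
  by rewrite /S set_row_id set_row_id.
have -> : S (row j M) (row i M) = xrow i j M.
  apply/matrixP => a b; rewrite !mxE.
  have [->|aj] := eqVneq a j; first by rewrite tpermR.
  have [->|ai] := eqVneq a i; first by rewrite tpermL.
  by rewrite tpermD// eq_sym.
by move=> /eqP; rewrite addr_eq0 => /eqP.
Qed.

(** A permutation is a product of transpositions, and each of them only flips the sign. *)
Lemma alternating_row_perm f M s : alternating_form f -> f M = 0 ->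
  f (row_perm s M) = 0.
Proof.
move=> af; have [ts -> ht] := prod_tpermP s.
elim: ts M ht => [|t ts IH] M /=; first by rewrite big_nil row_perm1.
move=> /andP[dt ht] fM; rewrite big_cons row_permM.
rewrite -/(xrow _ _ _) alternating_xrow// IH ?oppr0//.
Qed.

(** Multilinearity reduces to matrices whose rows are basis vectors; such a matrix has two equal
    rows or is a row permutation of the identity. *)
Lemma alternating_form0 f : alternating_form f -> f 1%:M = 0 ->
  forall M, f M = 0.
Proof.
move=> af f0 M.
(* Induction on the number [r] of leading rows still arbitrary; for [r = n] nothing is required of
   [N]. *)
suff H r : (r <= n)%N -> forall N : 'M[C]_n,
    (forall i : 'I_n, (r <= i)%N -> exists j, row i N = delta_mx 0 j) ->
    f N = 0.
  by apply: (H n) => // i; rewrite leqNgt ltn_ord.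
elim: r => [_|r IH rn] N hN.
  have /choice[s hs] : forall i, exists j, row i N = delta_mx 0 j.
    by move=> i; exact: hN.
  have [inj|/injectivePn[i [j ij sij]]] := boolP (injectiveb s); last first.
    by apply: (af.2 _ _ _ ij); rewrite !hs sij.
  have -> : N = row_perm (perm (injectiveP _ inj)) 1%:M.
    apply/row_matrixP => i; rewrite hs; apply/rowP => j.
    by rewrite !mxE permE eqxx eq_sym.
  exact: alternating_row_perm.
pose i0 := Ordinal rn.
rewrite -(set_row_id N i0) (row_sum_delta (row i0 N)).
elim/big_ind : _ => [|u v fu fv|j _].
(* Linearity with coefficient -1 and two zero vectors shows that a zero row gives the value 0. *)
- have := af.1 N i0 (-1) 0 0.
  by rewrite scaler0 addr0 mulN1r addNr.
- by rewrite -[u]scale1r af.1 fu fv mulr0 addr0.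
rewrite -[_ *: _]addr0 af.1.
have -> : f (set_row N i0 0) = 0.
  have := af.1 N i0 (-1) 0 0.
  by rewrite scaler0 addr0 mulN1r addNr.
rewrite addr0 IH ?mulr0 ?(ltnW rn)// => i.
rewrite leq_eqVlt => /orP[/eqP ri|ri].
  have -> : i = i0 by apply/val_inj.
  by exists j; rewrite row_set_row.
have [k hk] := hN i ri; exists k; rewrite row_set_row_neq//.
by apply/eqP => ii; rewrite ii ltnn in ri.
Qed.

(** The difference of the two sides is alternating in [M] and vanishes at the identity. *)
Lemma alternating_formE f M : alternating_form f -> f M = \det M * f 1%:M.
Proof.
move=> af; apply/eqP; rewrite -subr_eq0; apply/eqP.
apply: (@alternating_form0 (fun M => f M - \det M * f 1%:M)).
  exact: (alternating_formB _ af alternating_det).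
by rewrite det1 mul1r subrr.
Qed.

End AlternatingForm.

(** * Forms on several blocks *)

Section Pluriform.
Variables (R : realType) (n k : nat).
Implicit Type w : blocks R n k -> R[i].

Lemma pluriform_block w (B : blocks R n k) (i : 'I_k) : pluriform w ->
  alternating_form (fun M => w (fun j => if j == i then M else B j)).
Proof.
move=> [w1 w2]; split=> [M r a u v|M r s rs e]; last first.
  by apply: (w2 _ i r s rs); rewrite eqxx.
have E x : (fun j => if j == i then set_row M r x else B j) =
    set_vector (fun j => if j == i then M else B j) i r x.
  apply/funext => j; rewrite /set_vector; apply/matrixP => b c.
  by rewrite !mxE; case: eqP => //=; rewrite mxE.
by rewrite !E w1.
Qed.

(** The fibre is thus a line, with the value on identity blocks as coordinate. Blocks are replaced
    by the identity one at a time, each at the cost of its determinant. *)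
Lemma pluriformE w (B : blocks R n k) : pluriform w ->
  w B = (\prod_i \det (B i)) * w (fun=> 1%:M).
Proof.
move=> hw.
(* The blocks of index below [r] have already been replaced. *)
suff H r : (r <= k)%N ->
    w B = (\prod_(i < k | (i < r)%N) \det (B i)) *
          w (fun i => if (i < r)%N then 1%:M else B i).
  rewrite (H k)//; congr (_ * w _).
    by apply: eq_bigl => i; rewrite ltn_ord.
  by apply/funext => i; rewrite ltn_ord.
elim: r => [_|r IH rk]; first by rewrite big_pred0 ?mul1r.
rewrite (IH (ltnW rk)) [in RHS](bigD1 (Ordinal rk))//= -mulrA mulrCA.
congr (_ * _).
  apply: eq_bigl => i; rewrite ltnS ltn_neqAle andbC; congr (_ && _).
pose C (i : 'I_k) := if (i < r)%N then 1%:M else B i.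
have := @alternating_formE _ _ _ (B (Ordinal rk))
  (pluriform_block C (Ordinal rk) hw).
set X := fun j => _; set Y := fun j => _; move=> E.
transitivity (w X).
  congr w; apply/funext => i; rewrite /X /C; case: eqP => // ->.
  by rewrite ltnn.
rewrite E; congr (_ * w _); apply/funext => i.
by rewrite /Y /C ltnS (leq_eqVlt i) -val_eqE /=; case: eqP.
Qed.

End Pluriform.

Lemma pluriform_det (R : realType) (n : nat) (a : R[i]) :
  pluriform (fun B : blocks R n 1 => a * \det (B ord0)).
Proof.
have [d1 d2] := alternating_det R[i] n.
split=> [B i r b u v|B i r s rs]; last first.
  by rewrite (ord1 i) => e; rewrite (d2 _ _ _ rs e) mulr0.
have E x : set_vector B i r x ord0 = set_row (B ord0) r x.
  by apply/matrixP => c d; rewrite !mxE (ord1 i).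
by rewrite !E d1 mulrDr mulrCA.
Qed.

(** * Differentials *)

Section Differentials.
Variables (K : numFieldType) (V W : normedModType K).

(** The first-order expansion of [f] at [x] is also one of [g], and a continuous linear map with
    this property is unique. *)
Lemma near_eq_differentiable (f g : V -> W) (x : V) :
  (\near x, f x = g x) -> differentiable f x ->
  differentiable g x /\ 'd g x = 'd f x :> (V -> W).
Proof.
move=> fg df.
have H : g \o shift x = cst (g x) + 'd f x +o_ 0 id.
  apply/eqaddoP => e e0; move/eqaddoP : (diff_locally df) => /(_ e e0).
  apply: filter_app.
  have : \forall y \near (0 : V), f (shift x y) = g (shift x y).
    move: fg; rewrite (near_shift 0)/=.
    by apply: filterS => y /=; rewrite subr0.
  apply: filterS => y fgy.
  rewrite -![(_ - _) y]/(_ - _) -![(cst _ + _) y]/(_ + _) /=.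
  by move: fgy => /= ->; rewrite (nbhs_singleton fg).
have dg : 'd g x = 'd f x :> (V -> W).
  by apply: diff_unique => //; exact: diff_continuous.
split=> //; apply/diff_locallyP; rewrite dg; split=> //.
exact: diff_continuous.
Qed.

Lemma differentiable_locally_lipschitz (f : V -> W) (x : V) :
  differentiable f x ->
  exists2 c : K, 0 < c & \forall y \near x, `|f y - f x| <= c * `|y - x|.
Proof.
move=> df.
have [c c0 hc] := linear_lipschitz (diff_continuous df).
(* [c] bounds the differential; the extra 1 absorbs the remainder, which is at most the norm of the
   increment near [x]. *)
exists (c + 1); first exact: addr_gt0.
move/eqaddoP : (diff_locally df) => /(_ _ ltr01) H.
rewrite (near_shift 0)/=; move: H; apply: filterS => y.
rewrite -![(_ - _) y]/(_ - _) -![(cst _ + _) y]/(_ + _) /= => H.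
rewrite subr0 addrK mulrDl -(subrK ('d f x y) (_ - f x)).
rewrite (le_trans (ler_normD _ _))// addrC lerD//.
by rewrite -addrA -opprD.
Qed.

End Differentials.

(** * Scalar functions: products, sums and roots *)

Section ScalarFunctions.
Variable K : numFieldType.
Implicit Type V : normedModType K.

(* (p - p x) q differs from q x (p - p x) by O(|u - x|) o(1). *)
Lemma differentiable_mul_continuous V (p q : V -> K^o) (x : V) :
  differentiable p x -> {for x, continuous q} ->
  differentiable (fun u => (p u - p x) * q u : K^o) x.
Proof.
move=> dp cq.
have dpq : differentiable (fun u => (p u - p x) * (q u - q x) : K^o) x.
  pose z : {linear V -> K^o} := \0.
  have z0 : continuous (z : V -> K^o) by exact: cst_continuous.
  have H : (fun u => (p u - p x) * (q u - q x) : K^o) \o shift x =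
      cst ((p x - p x) * (q x - q x) : K^o) + (z : V -> K^o) +o_ 0 id.
    apply/eqaddoP => e e0.
    have [c c0 hc] := differentiable_locally_lipschitz dp.
    (* The bound [e / c] compensates the Lipschitz constant [c] of [p]. *)
    have hq : \forall u \near x, `|q x - q u| < e / c.
      by move/cvgrPdist_lt : cq; apply; rewrite divr_gt0.
    have : \forall u \near x, `|(p u - p x) * (q u - q x)| <= e * `|u - x|.
      move: hc hq; apply: filterS2 => u h1 /ltW h2.
      rewrite normrM (distrC (q u)) (le_trans (ler_pM _ _ h1 h2))//.
      by rewrite mulrC mulrA divfK ?gt_eqF//.
    rewrite (near_shift 0)/=; apply: filterS => y.
    rewrite -![(_ - _) y]/(_ - _) -![(cst _ + _) y]/(_ + _) /=.
    by rewrite !subr0 addrK !subrr mulr0 addr0 subr0.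
  have dz := diff_unique z0 H.
  by apply/diff_locallyP; rewrite dz.
have -> : (fun u => (p u - p x) * q u : K^o) =
    (fun u => (p u - p x) * (q u - q x) : K^o) + q x *: (p - cst (p x : K^o)).
  apply/funext => u.
  rewrite -[RHS]/((p u - p x) * (q u - q x) + q x * (p u - p x)).
  by rewrite (mulrC (q x)) -mulrDr subrK.
apply: differentiableD => //; apply: differentiableZ.
by apply: differentiableB => //; exact: differentiable_cst.
Qed.

Lemma continuous_sum V (T : topologicalType) (I : finType) (f : I -> T -> V)
    (x : T) :
  (forall i, {for x, continuous (f i)}) ->
  {for x, continuous (fun u => \sum_i f i u)}.
Proof.
move=> cf; apply: (@cvg_big _ _ _ _ _ _ _ _ _ _ (fun i => f i x)) => //.
  exact: add_continuous.
by move=> i _; exact: cf.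
Qed.

Lemma continuous_prod (T : topologicalType) (I : finType) (f : I -> T -> K^o)
    (x : T) :
  (forall i, {for x, continuous (f i)}) ->
  {for x, continuous (fun u => \prod_i f i u : K^o)}.
Proof.
move=> cf; apply: (@cvg_big _ _ _ _ _ _ _ _ _ _ (fun i => f i x)) => //.
  exact: mul_continuous.
by move=> i _; exact: cf.
Qed.

Lemma continuous_exp (T : topologicalType) (f : T -> K^o) (x : T) n :
  {for x, continuous f} -> {for x, continuous (fun u => f u ^+ n : K^o)}.
Proof.
move=> cf; have -> : (fun u => f u ^+ n : K^o) = (fun u => \prod_(i < n) f u).
  by apply/funext => u; rewrite prodr_const card_ord.
exact: (@continuous_prod _ _ (fun=> f)).
Qed.

(* Factor h^k - h(x)^k = (h - h(x)) Q, with Q continuous and nonzero at x. *)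
Lemma differentiable_root V (h : V -> K^o) (x : V) (k : nat) : (0 < k)%N ->
  {for x, continuous h} -> h x != 0 ->
  differentiable (fun u => h u ^+ k : K^o) x -> differentiable h x.
Proof.
move=> k0 ch hx dh.
pose Q u : K^o := \sum_(i < k) h u ^+ (k.-1 - i) * h x ^+ i.
have cQ : {for x, continuous Q}.
  apply: (@continuous_sum K^o) => i.
  apply: continuousM; last exact: cst_continuous.
  exact: continuous_exp.
have Qx : Q x != 0.
  (* At [x] all [k] summands coincide, so [Q x] is [k] times a power of [h x], nonzero in
     characteristic 0. *)
  rewrite /Q (eq_bigr (fun=> h x ^+ k.-1)); last first.
    by move=> i _; rewrite -exprD subnK// -ltnS prednK.
  by rewrite sumr_const card_ord mulrn_eq0 negb_or -lt0n k0/= expf_neq0.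
have cQV : {for x, continuous (fun u => (Q u)^-1 : K^o)}.
  exact: continuousV.
(* Near [x], [h] is [h x] plus the increment of its [k]-th power divided by [Q]; continuity of the
   inverse of [Q] is enough for this product to be differentiable at [x]. *)
have d := differentiableD (differentiable_cst (h x : K^o) x)
  (differentiable_mul_continuous dh cQV).
apply: (proj1 (near_eq_differentiable _ d)).
have : \forall u \near x, Q u != 0 by exact: (cvgr_neq0 _ cQ Qx).
apply: filterS => u Qu /=.
rewrite -[LHS]/(h x + (h u ^+ k - h x ^+ k) * (Q u)^-1).
by rewrite subrXX -/(Q u) mulfK// addrC subrK.
Qed.

End ScalarFunctions.

(** * Charts and local representatives *)

Lemma near_eq_continuous (T U : topologicalType) (f g : T -> U) x :
  (\near x, f x = g x) -> {for x, continuous g} -> {for x, continuous f}.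
Proof.
move=> fg cg; rewrite /continuous_at /prop_for (nbhs_singleton fg).
apply: cvg_trans cg; apply: near_eq_cvg.
by apply: filterS fg.
Qed.

Section Charts.
Variables (M E : topologicalType) (c : chart M E).
Hypothesis hc : is_chart c.

Lemma cmapK x : cdom c x -> cinv c (cmap c x) = x.
Proof. by case: hc => _ _ + _ _; exact. Qed.

Lemma near_cdom x : cdom c x -> \near x, cdom c x.
Proof. by case: hc => oc _ _ _ _ cx; exact: open_nbhs_nbhs. Qed.

Lemma cmap_continuous x : cdom c x -> {for x, continuous (cmap c)}.
Proof.
case: hc => oc _ _ cc _ cx.
by rewrite continuous_open_subspace// in cc; apply: cc; rewrite inE.
Qed.

Lemma cinv_continuous x : cdom c x -> {for cmap c x, continuous (cinv c)}.
Proof.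
case: hc => _ oc _ _ cc cx.
by rewrite continuous_open_subspace// in cc; apply: cc; rewrite inE; exists x.
Qed.

(** This turns identities between local representatives near [cmap c x] into identities at points of
    the manifold near [x]. *)
Lemma near_cmap x (P : set M) : cdom c x -> nbhs x P ->
  \forall u \near cmap c x, exists y, [/\ cdom c y, P y & u = cmap c y].
Proof.
move=> cx Px.
have oc : open (cmap c @` cdom c) by case: hc.
have h1 : \forall u \near cmap c x, (cmap c @` cdom c) u.
  by apply: open_nbhs_nbhs; split=> //; exists x.
have h2 : \forall u \near cmap c x, P (cinv c u).
  by apply: (cinv_continuous cx); rewrite cmapK.
apply: filterS2 h1 h2 => _ [y cy <-]; rewrite cmapK// => Py.
by exists y.
Qed.

End Charts.

Section LocalRep.
Variables (M E : topologicalType) (N E' : Type).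
Variables (c : chart M E) (d : chart N E').
Hypothesis hc : is_chart c.

Lemma local_repE (F : M -> N) x : cdom c x ->
  local_rep c d F (cmap c x) = cmap d (F x).
Proof. by move=> cx; rewrite /local_rep /= cmapK. Qed.

End LocalRep.

Section LocalRepComp.
Variables (M N E E' : topologicalType) (P E'' : Type).
Variables (c : chart M E) (d : chart N E') (e : chart P E'').
Hypotheses (hc : is_chart c) (hd : is_chart d).

(** The equality is local because the middle chart [d] must contain the image under [F], which
    continuity ensures close to [x]. *)
Lemma near_local_rep_comp (F : M -> N) (G : N -> P) x :
  cdom c x -> cdom d (F x) -> {for x, continuous F} ->
  \forall u \near cmap c x, local_rep c e (G \o F) u =
    (local_rep d e G \o local_rep c d F) u.
Proof.
move=> cx dx cF.
have := near_cmap hc cx (cF _ (near_cdom hd dx)).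
apply: filterS => _ [y [cy dFy ->]].
by rewrite /local_rep /= cmapK// cmapK.
Qed.

End LocalRepComp.

(** * Jacobian matrices acting on row vectors *)

Section Jacobian.
Variable K : numFieldType.

Lemma mul_jacobian (m n : nat) (f : 'rV[K]_m -> 'rV[K]_n) x v :
  v *m 'J f x = 'd f x v.
Proof. exact: mul_rV_lin1. Qed.

Lemma row_jacobian (m n : nat) (f : 'rV[K]_m -> 'rV[K]_n) x i :
  row i ('J f x) = 'd f x (delta_mx 0 i).
Proof. by rewrite rowE mul_jacobian. Qed.

Lemma diff_row_sum (m : nat) (W : normedModType K) (f : 'rV[K]_m -> W) x w :
  'd f x w = \sum_j w 0 j *: 'd f x (delta_mx 0 j).
Proof.
rewrite {1}[w]row_sum_delta linear_sum.
by apply: eq_bigr => j _; rewrite linearZ.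
Qed.

Lemma jacobian_id (m : nat) (x : 'rV[K]_m) :
  'J (fun u : 'rV[K]_m => u) x = 1%:M.
Proof.
apply/row_matrixP => i; rewrite row_jacobian row1.
exact: (congr1 (@^~ (delta_mx 0 i)) (diff_val (f := fun u : 'rV[K]_m => u))).
Qed.

(** Matrices act on rows from the right, so the inner map comes first in the product. *)
Lemma jacobian_comp (l m n : nat) (f : 'rV[K]_l -> 'rV[K]_m)
    (g : 'rV[K]_m -> 'rV[K]_n) x :
  differentiable f x -> differentiable g (f x) ->
  'J (g \o f) x = 'J f x *m 'J g (f x).
Proof.
move=> df dg; apply/row_matrixP => i; rewrite row_mul !rowE !mul_jacobian.
by rewrite (diff_comp df dg).
Qed.

Lemma near_eq_jacobian (m n : nat) (f g : 'rV[K]_m -> 'rV[K]_n) x :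
  (\near x, f x = g x) -> differentiable f x -> 'J f x = 'J g x.
Proof.
move=> fg df; have [dg e] := near_eq_differentiable fg df.
apply/row_matrixP => i; apply: etrans (row_jacobian f x i) _.
apply: etrans (esym (row_jacobian g x i)).
exact: (congr1 (@^~ (delta_mx 0 i)) (esym e)).
Qed.

Lemma near_eq_differentiableP (V W : normedModType K) (f g : V -> W) x :
  (\near x, f x = g x) -> differentiable g x -> differentiable f x.
Proof.
move=> fg dg; apply: (proj1 (near_eq_differentiable _ dg)).
by apply: filterS fg.
Qed.

End Jacobian.

Section HolomorphicMap.
Variables (R : realType) (M N : topologicalType) (V W : normedModType R[i]).
Variables (A : set (chart M V)) (B : set (chart N W)) (F : M -> N).

Lemma holomorphic_map_differentiable c d x : holomorphic_map A B F ->
  A c -> B d -> cdom c x -> cdom d (F x) ->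
  differentiable (local_rep c d F) (cmap c x).
Proof. by move=> [_ hF] Ac Bd cx dx; apply: (hF _ _ Ac Bd); exists x. Qed.

End HolomorphicMap.

(** * Smooth dependence of left translations on the group element *)

Section SmoothMap.
Variables (R : realType) (M N : topologicalType) (V W : normedModType R).
Variables (A : set (chart M V)) (B : set (chart N W)) (F : M -> N).
Variables (c : chart M V) (d : chart N W) (x : M).
Hypotheses (hF : smooth_map A B F) (Ac : A c) (Bd : B d).
Hypotheses (cx : cdom c x) (dx : cdom d (F x)).

Let local_domx : local_dom c d F (cmap c x). Proof. by exists x. Qed.

Lemma smooth_map_differentiable : differentiable (local_rep c d F) (cmap c x).
Proof. by have [h _] := hF.2 _ _ Ac Bd 1%N; exact: h. Qed.

Lemma smooth_map_derive_continuous v :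
  {for cmap c x, continuous ('D_v (local_rep c d F))}.
Proof. by have [_ h] := hF.2 _ _ Ac Bd 1%N; exact: h. Qed.

End SmoothMap.

Section LieGroup.
Variables (R : realType) (m : nat) (G : topGroupType).
Variables (S T : set (chart G 'rV[R]_m)).
Hypotheses (lieS : lie_group S) (hST : smooth_atlas (S `|` T)).

Let mul_smooth : smooth_map (prod_atlas S S) S (fun x : G * G => (x.1 * x.2)%g).
Proof. by case: lieS. Qed.

Lemma mulg_continuous : continuous (fun x : G * G => (x.1 * x.2)%g).
Proof. by case: mul_smooth. Qed.

Lemma invg_continuous : continuous (fun x : G => (x^-1)%g).
Proof. by case: lieS => _ _ _ _ []. Qed.

Lemma mulgl_continuous (g : G) : continuous (fun x : G => (g * x)%g).
Proof.
move=> x; apply: (@continuous2_cvg _ _ _ _ (nbhs x) _ (cst g) id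
  (fun y z => y * z)%g).
- exact: (mulg_continuous (x := (g, x))).
- exact: cvg_cst.
- exact: cvg_id.
Qed.

Section Derivative.
Variables (r r0 a b d : chart G 'rV[R]_m).
Hypotheses (Tr : T r) (Tr0 : T r0) (Sa : S a) (Sb : S b) (Sd : S d).
Hypotheses (r01 : cdom r0 1%g) (d1 : cdom d 1%g).

Let chST c : (S `|` T) c -> is_chart c.
Proof. by move=> STc; case: hST => -[+ _] _; exact. Qed.

Let chr : is_chart r. Proof. by apply: chST; right. Qed.
Let cha : is_chart a. Proof. by apply: chST; left. Qed.
Let chb : is_chart b. Proof. by apply: chST; left. Qed.
Let chd : is_chart d. Proof. by apply: chST; left. Qed.

(** [psi] and [phi] pass between the charts of [T] and those of [S], in which multiplication, read
    as [mu], is smooth. *)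
Let psi := local_rep r b id.
Let phi := local_rep d r0 id.
Let mu := local_rep (prod_chart a b) d (fun x : G * G => (x.1 * x.2)%g).

(** Chain rule for [phi] after [mu] with its first argument frozen, after [psi]. The point [y] then
    enters only through the points where derivatives of the fixed maps [psi] and [mu] are taken,
    while [phi] is differentiated at a fixed point. *)
Lemma derive_left_translation y v : cdom r y -> cdom b y -> cdom a (y^-1)%g ->
  'D_v (local_rep r r0 (fun z => (y^-1 * z)%g)) (cmap r y) =
  (\sum_j 'D_v psi (cmap r y) 0 j *:
     'D_((0 : 'rV_m, delta_mx 0 j)) mu (cmap a (y^-1)%g, cmap b y)) *m
  'J phi (cmap d 1%g).
Proof.
move=> ry by_ ay.
have dpsi : differentiable psi (cmap r y).
  by apply: (smooth_map_differentiable (proj2 hST)) => //; [right|left].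
have dphi : differentiable phi (cmap d 1%g).
  by apply: (smooth_map_differentiable (proj2 hST)) => //; [left|right].
have dmu : differentiable mu (cmap a y^-1, cmap b y)%g.
  apply: (smooth_map_differentiable (c := prod_chart a b) (x := (y^-1, y)%g)
    mul_smooth) => //=; last by rewrite mulVg.
  by exists a => //; exists b.
pose p w : 'rV[R]_m * 'rV[R]_m := (cmap a (y^-1)%g, w).
have dp w : is_diff w p (fun u => (0, u)).
  exact: is_diff_pair.
pose nu w := mu (p w).
have dnu : differentiable nu (cmap b y).
  by apply: differentiable_comp.
have dnuE u : 'd nu (cmap b y) u = 'D_(0, u) mu (p (cmap b y)).
  by rewrite deriveE// diff_comp//= diff_val.
have psiE : psi (cmap r y) = cmap b y by rewrite /psi local_repE.
have nuE : nu (cmap b y) = cmap d 1%g.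
  by rewrite /nu /mu /local_rep /= !cmapK// mulVg.
(* The factorization is valid only while [z] stays in [b] and the product in [d]. *)
have e : \forall u \near cmap r y,
    local_rep r r0 (fun z => (y^-1 * z)%g) u = (phi \o (nu \o psi)) u.
  have P : \forall z \near y, cdom d (y^-1 * z)%g.
    apply: (mulgl_continuous (x := y)); rewrite mulVg.
    exact: near_cdom.
  apply: filterS (near_cmap chr ry (filterI (near_cdom chb by_) P)).
  move=> _ [z [rz [bz dz] ->]].
  by rewrite /phi /nu /mu /psi /local_rep /= !cmapK.
rewrite (near_eq_derive _ e).
have dnu' : differentiable nu (psi (cmap r y)) by rewrite psiE.
have dnp := differentiable_comp dpsi dnu'.
have npE : (nu \o psi) (cmap r y) = cmap d 1%g by rewrite /= psiE.
have dphi' : differentiable phi ((nu \o psi) (cmap r y)) by rewrite npE.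
apply: etrans (deriveE v (differentiable_comp dnp dphi')) _.
apply: etrans (congr1 (@^~ v) (diff_comp dnp dphi')) _.
rewrite npE; apply: etrans (esym (mul_jacobian phi (cmap d 1%g) _)).
apply: (congr1 ('d phi (cmap d 1%g))).
apply: etrans (congr1 (@^~ v) (diff_comp dpsi dnu')) _.
apply: etrans (diff_row_sum nu (psi (cmap r y)) _) _; apply: eq_bigr => j _.
rewrite psiE; apply: (congr2 *:%R); last exact: dnuE.
exact: (congr1 (fun w : 'rV_m => w 0 j) (esym (deriveE v dpsi))).
Qed.

(** Every ingredient of the chain rule formula depends continuously on [y], by the C^1 regularity of
    [psi] and [mu]. *)
Lemma derive_left_translation_continuous_at x v : cdom r x -> cdom b x ->
  cdom a (x^-1)%g ->
  {for x, continuous (fun y =>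
    'D_v (local_rep r r0 (fun z => (y^-1 * z)%g)) (cmap r y))}.
Proof.
move=> rx bx ax.
have near_ax : \forall y \near x, cdom a (y^-1)%g.
  exact: (invg_continuous (near_cdom cha ax)).
pose p y := (cmap a (y^-1)%g, cmap b y).
have cp : {for x, continuous p}.
  have c1 : {for x, continuous (fun y => cmap a (y^-1)%g)}.
    apply: (continuous_comp (invg_continuous (x := x))).
    exact: cmap_continuous.
  exact: (cvg_pair c1 (cmap_continuous chb bx)).
pose q y : 'rV[R]_m := \sum_j 'D_v psi (cmap r y) 0 j *:
  'D_((0 : 'rV_m, delta_mx 0 j)) mu (p y).
have cq : {for x, continuous q}.
  have cpsi : {for cmap r x, continuous ('D_v psi)}.
    by apply: (smooth_map_derive_continuous (proj2 hST)) => //; [right|left].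
  have cpsij j : {for x, continuous (fun y => 'D_v psi (cmap r y) 0 j : R^o)}.
    have cj : continuous (fun u : 'rV[R]_m => u 0 j : R^o).
      exact: coord_continuous.
    have c1 := continuous_comp (cmap_continuous chr rx) cpsi.
    exact: (continuous_comp c1 (cj _)).
  have cmu u : {for p x, continuous ('D_u mu)}.
    apply: (smooth_map_derive_continuous (c := prod_chart a b)
      (x := (x^-1, x)%g) mul_smooth) => //=; last by rewrite mulVg.
    by exists a => //; exists b.
  apply: continuous_sum => j.
  exact: (cvgZ (cpsij j) (continuous_comp cp (cmu _))).
have dphi : differentiable phi (cmap d 1%g).
  by apply: (smooth_map_differentiable (proj2 hST)) => //; [left|right].
apply: (@near_eq_continuous _ _ _ ('d phi (cmap d 1%g) \o q)); last first.
  by apply: (continuous_comp cq); exact: diff_continuous.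
move: (near_cdom chr rx) (near_cdom chb bx) near_ax.
apply: filterS3 => y ry by_ ay.
by rewrite derive_left_translation//= mul_jacobian.
Qed.

End Derivative.

Lemma derive_left_translation_continuous r r0 x v : T r -> T r0 ->
  cdom r x -> cdom r0 1%g ->
  {for x, continuous (fun y =>
    'D_v (local_rep r r0 (fun z => (y^-1 * z)%g)) (cmap r y))}.
Proof.
move=> Tr Tr0 rx r01; case: (lieS) => _ _ [[_ hS] _] _ _.
have [a Sa ax] := hS (x^-1)%g; have [b Sb bx] := hS x.
have [d Sd d1] := hS 1%g.
exact: (@derive_left_translation_continuous_at r r0 a b d).
Qed.

End LieGroup.

(** * Real and complex differentials *)

(** The two spaces may have radii in different fields, as for [realify]; [phi] converts a target
    radius into a source radius. *)
Lemma ball_continuous (K L : numFieldType) (V : pseudoMetricType K)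
    (W : pseudoMetricType L) (f : V -> W) (phi : L -> K) :
  (forall e, 0 < e -> 0 < phi e) ->
  (forall x y e, ball x (phi e) y -> ball (f x) e (f y)) -> continuous f.
Proof.
move=> phi0 fphi x; apply/cvg_ballP => e e0.
by apply: filterS (nbhsx_ballx x _ (phi0 e e0)) => y; exact: fphi.
Qed.

Lemma normc_ge_Im (R : rcfType) (x : R[i]) : `|complex.Im x|%:C <= `|x|.
Proof.
by case: x => a b; simpc; rewrite -sqrtr_sqr ler_wsqrtr// lerDr sqr_ge0.
Qed.

Section Realification.
Variables (R : realType) (n : nat).

Lemma realifyK : cancel (@realify R n) (@complexify R n).
Proof.
move=> z; apply/rowP => j; rewrite mxE row_mxKl row_mxKr !mxE.
by case: (z 0 j).
Qed.

Lemma realifyD : {morph @realify R n : z w / z + w}.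
Proof.
by move=> z w; rewrite /realify !map_mxD add_row_mx. Qed.

Lemma realifyZ (a : R) z : realify (a%:C *: z) = a *: @realify R n z.
Proof.
rewrite /realify scale_row_mx; congr row_mx; apply/matrixP => i j;
  by rewrite !mxE; case: (z i j) => x y /=; rewrite mul0r ?subr0 ?addr0.
Qed.

Lemma realifyB : {morph @realify R n : z w / z - w}.
Proof.
by move=> z w; rewrite /realify !map_mxB opp_row_mx add_row_mx.
Qed.

Lemma realify_continuous : continuous
  (@realify R n : ('rV[R[i]]_n : normedModType R[i]) -> 'rV[R]_(n + n)).
Proof.
apply: (@ball_continuous _ _ _ _ _ (real_complex R)) => [e|z t e [e0 zt]].
  by rewrite ltcR.
split=> [|i j]; first by rewrite -ltcR.
rewrite !mxE.
case: splitP => k _; rewrite !mxE; have := zt i k;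
  rewrite -!ball_normE /= -ltcR; apply: le_lt_trans.
- by rewrite -raddfB; exact: normc_ge_Re.
- by rewrite -raddfB; exact: normc_ge_Im.
Qed.

End Realification.

Lemma real_complex_continuous (R : realType) :
  continuous (real_complex R : R -> R[i]^o).
Proof.
move=> x; apply/cvgrPdist_lt => e.
case: e => a b; rewrite ltcE /= => /andP[/eqP -> a0].
have : \forall t \near x, `|x - t| < a.
  by apply: nbhsx_ballx.
apply: filterS => t xt; rewrite -rmorphB /= normc_def /=.
by rewrite expr0n /= addr0 sqrtr_sqr ltcR.
Qed.

(** The real difference quotient is the complex one along real increments, and [realify] is real
    linear and continuous, so it passes to the limit. *)
Lemma derive_realify (R : realType) (m n : nat)
    (P : ('rV[R[i]]_m : normedModType R[i]) ->
         ('rV[R[i]]_n : normedModType R[i]))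
    (u v : ('rV[R[i]]_m : normedModType R[i])) :
  differentiable P u ->
  'D_(realify v) (@realify R n \o P \o @complexify R m) (realify u) =
  realify ('D_v P u).
Proof.
move=> dP; apply: cvg_lim => //.
(* Nonzero real increments tending to 0 are nonzero complex increments tending to 0. *)
have h1 : (fun h : R => h%:C : (R[i] : numFieldType)) @ 0^' -->
      (0 : (R[i] : numFieldType))^'.
  move=> U U0; have H : nbhs (0 : R) (fun h : R => h%:C != 0 :> R[i] -> U h%:C).
    exact: (@real_complex_continuous R 0 _ U0).
  change (nbhs (0 : R) (fun h : R => h != 0 -> U h%:C)).
  apply: filterS H => h + h0; apply.
  by rewrite -(rmorph0 (real_complex R)) (inj_eq (@complexI R)).
have h2 := cvg_comp _ _ h1 (diff_derivable (v := v) dP).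
have h3 := cvg_comp _ _ h2 (@realify_continuous R n ('D_v P u)).
apply: cvg_trans h3; apply: near_eq_cvg; apply: nearW => h /=.
have -> : (h%:C)^-1 = (h^-1)%:C :> R[i] by rewrite fmorphV.
rewrite realifyZ realifyB.
by rewrite realifyK -realifyZ -realifyD realifyK.
Qed.

(** * The invariant density *)

Section InvariantDensity.
Variables (R : realType) (n : nat) (G : topGroupType).
Variables (SG : set (chart G 'rV[R]_(n + n))) (A : set (chart G 'rV[R[i]]_n)).
Hypotheses (lieG : lie_group SG) (cplx : complex_structure SG A).
Hypothesis linv : left_invariant_structure A.
Local Notation Cn := ('rV[R[i]]_n : normedModType R[i]).
Variable c0 : chart G 'rV[R[i]]_n.
Hypotheses (Ac0 : A c0) (c01 : cdom c0 1%g).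

Definition translation_jacobian (c d : chart G 'rV[R[i]]_n) (g x : G) :=
  'J (local_rep c d (fun y => (g * y)%g)) (cmap c x).

Definition invariant_density (c : chart G 'rV[R[i]]_n) (x : G) : R[i] :=
  \det (translation_jacobian c c0 x^-1%g x).

Let chA c : A c -> is_chart (c : chart G Cn).
Proof. by move=> Ac; case: cplx => -[[+ _] _] _; exact. Qed.

Lemma translation_differentiable c d g x : A c -> A d -> cdom c x ->
  cdom d (g * x)%g ->
  differentiable
    (local_rep c d (fun y => (g * y)%g) : Cn -> Cn) (cmap c x : Cn).
Proof.
by move=> Ac Ad cx dx; apply: (holomorphic_map_differentiable (linv g)).
Qed.

Lemma translation_jacobianM c d e g h x : A c -> A d -> A e -> cdom c x ->
  cdom d (g * x)%g -> cdom e (h * (g * x))%g ->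
  translation_jacobian c e (h * g)%g x =
  translation_jacobian c d g x *m translation_jacobian d e h (g * x)%g.
Proof.
move=> Ac Ad Ae cx dx ex.
have -> : translation_jacobian c e (h * g)%g x =
    'J (local_rep c e ((fun y => h * y) \o (fun y => g * y))%g) (cmap c x).
  rewrite /translation_jacobian; congr ('J (local_rep c e _) _).
  by apply/funext => y; rewrite /= mulgA.
have dg := translation_differentiable Ac Ad cx dx.
have gxE := local_repE d (chA Ac) (fun y => (g * y)%g) cx.
have dh : differentiable (local_rep d e (fun y => (h * y)%g) : Cn -> Cn)
    (local_rep c d (fun y => (g * y)%g) (cmap c x) : Cn).
  by rewrite gxE; exact: translation_differentiable.
have E := near_local_rep_comp e (chA Ac) (chA Ad) (fun y => (h * y)%g) cx dx
  (mulgl_continuous lieG (x := x)).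
have dgh := differentiable_comp dg dh.
apply: etrans (near_eq_jacobian E (near_eq_differentiableP E dgh)) _.
by apply: etrans (jacobian_comp dg dh) _; rewrite gxE.
Qed.

(** The translation taking [x] to the identity factors through [g * x]; take determinants in the
    chain rule. *)
Lemma invariant_density_translate c d g x : A c -> A d -> cdom c x ->
  cdom d (g * x)%g ->
  invariant_density c x =
  \det (translation_jacobian c d g x) * invariant_density d (g * x)%g.
Proof.
move=> Ac Ad cx dx.
have xE : (x^-1 = (g * x)^-1 * g)%g by rewrite invgM mulgVK.
have ex : cdom c0 ((g * x)^-1 * (g * x))%g by rewrite mulVg.
rewrite /invariant_density xE (translation_jacobianM Ac Ad Ac0 cx dx ex).
exact: det_mulmx.
Qed.

(** Joint regularity of the group law is given over the reals, so each complex entry is rebuilt from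
    the two halves of a real directional derivative; the determinant is polynomial in the
    entries. *)
Lemma invariant_density_continuous c x : A c -> cdom c x ->
  {for x, continuous (invariant_density c : G -> R[i]^o)}.
Proof.
move=> Ac cx.
pose rc := real_chart c; pose rc0 := real_chart c0.
pose T := @real_chart R n G @` A.
have Trc : T rc by exists c.
have Trc0 : T rc0 by exists c0.
pose D v y : 'rV[R]_(n + n) :=
  'D_v (local_rep rc rc0 (fun z => (y^-1 * z)%g)) (cmap rc y).
have cD v : {for x, continuous (D v)}.
  exact: (derive_left_translation_continuous lieG (proj2 cplx)).
have cDk v k : {for x, continuous (fun y => D v y 0 k : R^o)}.
  have ck : continuous (fun u : 'rV[R]_(n + n) => u 0 k : R^o).
    exact: coord_continuous.
  exact: (continuous_comp (cD v) (ck _)).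
have cJ i j : {for x, continuous
    (fun y => translation_jacobian c c0 y^-1%g y i j : R[i]^o)}.
  (* Differentiating along the [i]-th basis vector yields row [i] of the Jacobian. *)
  pose v := realify (delta_mx 0 i : 'rV[R[i]]_n).
  apply: (@near_eq_continuous _ _ _ (fun y =>
      (D v y 0 (lshift n j))%:C + 'i%C * (D v y 0 (rshift n j))%:C : R[i]^o)).
    have nx : \near x, cdom c x by exact: (near_cdom (chA Ac) cx).
    have gn : forall y, cdom c y -> translation_jacobian c c0 y^-1%g y i j =
        (D v y 0 (lshift n j))%:C + 'i%C * (D v y 0 (rshift n j))%:C.
      move=> y cy; have dy : differentiable
          (local_rep c c0 (fun z => (y^-1 * z)%g) : Cn -> Cn) (cmap c y : Cn).
        by apply: translation_differentiable => //; rewrite mulVg.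
      have -> : D v y = realify (row i (translation_jacobian c c0 y^-1%g y)).
        rewrite row_jacobian -(deriveE _ dy) -derive_realify//.
      by rewrite !row_mxEl !row_mxEr !mxE -complexE.
    by apply: filterS nx => y cy; exact: gn.
  have h1 := cDk v (lshift n j); have h2 := cDk v (rshift n j).
  have h1' := continuous_comp h1 (@real_complex_continuous R _).
  have h2' := continuous_comp h2 (@real_complex_continuous R _).
  apply: (continuousD h1').
  apply: (continuousM _ h2'); exact: cst_continuous.
apply: continuous_sum => s; apply: continuousM; first exact: cst_continuous.
by apply: continuous_prod => i; exact: cJ.
Qed.

Definition density_section : sections R n 1 G :=
  fun c x B => invariant_density c x * \det (B ord0).

Lemma density_section_invariant : left_invariant_section A density_section.
Proof.
move=> g c d x Ac Ad cx dx; apply/funext => B.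
rewrite /density_section /pull_form det_mulmx.
rewrite (invariant_density_translate Ac Ad cx dx) mulrAC mulrC.
by rewrite [in RHS]mulrA [in RHS]mulrAC -mulrA mulrC.
Qed.

(** A change of charts is the translation by 1, so compatibility is a case of invariance. *)
Lemma density_section_is_section : is_section A density_section.
Proof.
split=> [c x _ _|]; first exact: pluriform_det.
have := @density_section_invariant 1%g.
by have -> : (fun x : G => (1 * x)%g) = id by apply/funext => x; rewrite mul1g.
Qed.

(** * Comparison with an invariant section of the tensor power *)

Section TensorPower.
Variables (k : nat) (s : sections R n k G).
Hypotheses (k0 : (0 < k)%N) (hs : is_section A s).
Hypotheses (sinv : left_invariant_section A s) (snz : nonzero_section A s).

(** Each of the [k] blocks contributes the same determinant. *)
Lemma invariant_section_translate c d g x : A c -> A d -> cdom c x ->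
  cdom d (g * x)%g ->
  s c x (fun=> 1%:M) =
  \det (translation_jacobian c d g x) ^+ k * s d (g * x)%g (fun=> 1%:M).
Proof.
move=> Ac Ad cx dx; rewrite (sinv Ac Ad cx dx) /pull_form.
rewrite (pluriformE _ (hs.1 _ _ Ad dx)); congr (_ * _).
by under eq_bigr do rewrite mul1mx; rewrite prodr_const card_ord.
Qed.

Lemma invariant_section_value c x : A c -> cdom c x ->
  s c x (fun=> 1%:M) = invariant_density c x ^+ k * s c0 1%g (fun=> 1%:M).
Proof.
move=> Ac cx.
have e : cdom c0 (x^-1 * x)%g by rewrite mulVg.
by rewrite (invariant_section_translate Ac Ac0 cx e) mulVg.
Qed.

(** Translation by [x * y^-1] carries a point [y] where [s] is nonzero to [x]. *)
Lemma invariant_section_neq0 c x : A c -> cdom c x ->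
  s c x (fun=> 1%:M) != 0.
Proof.
move=> Ac cx; have [d [y [B [Ad dy sB]]]] := snz.
have e : cdom c ((x * y^-1) * y)%g by rewrite mulgVK.
move: sB; rewrite (pluriformE _ (hs.1 _ _ Ad dy)).
rewrite (invariant_section_translate Ad Ac dy e) mulgVK.
by rewrite !mulf_eq0 !negb_or => /and3P[].
Qed.

(** As [k] is positive, a zero density would make the component of [s] vanish. *)
Lemma invariant_density_neq0 c x : A c -> cdom c x ->
  invariant_density c x != 0.
Proof.
move=> Ac cx; have := invariant_section_neq0 Ac cx.
rewrite (invariant_section_value Ac cx) mulf_eq0 negb_or expf_eq0 k0.
by move=> /andP[].
Qed.

Lemma density_section_frame : frame A density_section.
Proof.
move=> c x Ac cx w hw.
have h0 := invariant_density_neq0 Ac cx.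
(* A form is determined by its value on the identity block, where the section equals the density. *)
exists (w (fun=> 1%:M) / invariant_density c x); split.
  apply/funext => B; rewrite (pluriformE B hw) big_ord1.
  by rewrite /density_section mulrA divfK// mulrC.
move=> a /(congr1 (@^~ (fun=> 1%:M))) /= ->.
by rewrite /density_section det1 mulr1 mulfK.
Qed.

Lemma density_section_nonzero : nonzero_section A density_section.
Proof.
exists c0, 1%g, (fun=> 1%:M); split=> //.
by rewrite /density_section det1 mulr1 invariant_density_neq0.
Qed.

Lemma density_section_holomorphic : holomorphic_section A s ->
  holomorphic_section A density_section.
Proof.
move=> [_ hol]; split; first exact: density_section_is_section.
move=> c B Ac u cu; case: (cu) => x cx xu.
pose h : Cn -> R[i]^o := fun u => invariant_density c (cinv c u).
have cxx := cmapK (chA Ac) cx.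
have ch : {for u, continuous h}.
  have h1 := cinv_continuous (chA Ac) cx.
  have h2 := invariant_density_continuous Ac cx.
  by rewrite -xu; apply: (continuous_comp h1); rewrite cxx.
have hu : h u != 0 by rewrite /h -xu cxx invariant_density_neq0.
have f0 : s c0 1%g (fun=> 1%:M) != 0 by exact: invariant_section_neq0.
have dh : differentiable h u.
  apply: (differentiable_root k0 ch hu).
  (* Dividing the component of [s] by its value at the identity leaves the [k]-th power of [h]. *)
  have d := differentiableZ (s c0 1%g (fun=> 1%:M))^-1
    (hol c (fun=> 1%:M) Ac u cu).
  apply: near_eq_differentiableP d.
  rewrite -xu; apply: filterS (near_cmap (chA Ac) cx filterT).
  move=> _ [y [cy _ ->]].
  rewrite /h /= -[RHS]/(_ * _) (cmapK (chA Ac) cy).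
  by rewrite (invariant_section_value Ac cy) mulrC mulfK.
have -> : (fun v : Cn => density_section c (cinv c v) B : R[i]^o) =
    \det (B ord0) *: h.
  by apply/funext => v; rewrite /density_section mulrC.
exact: differentiableZ.
Qed.

End TensorPower.

End InvariantDensity.

(** * Quotients by discrete subgroups *)

Section Quotient.
Variables (R : realType) (n : nat) (G : topGroupType).
Variables (SG : set (chart G 'rV[R]_(n + n))) (A : set (chart G 'rV[R[i]]_n)).
Hypotheses (lieG : lie_group SG) (cplx : complex_structure SG A).
Hypothesis linv : left_invariant_structure A.
Variable Gam : groupClosed G.
Local Notation Cn := ('rV[R[i]]_n : normedModType R[i]).
Local Notation proj := (@to_quotient G Gam).

Let chA c : A c -> is_chart (c : chart G Cn).
Proof. by move=> Ac; case: cplx => -[[+ _] _] _; exact. Qed.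

Lemma to_quotient_eq x y :
  proj x = proj y <-> exists2 g : G, g \in Gam & y = (g * x)%g.
Proof.
split=> [|[g gG ->]].
  move/eqmodP; rewrite /= /same_orbit => h; exists (y * x^-1)%g => //.
  by rewrite mulgVK.
by apply/eqmodP; rewrite /= /same_orbit mulgK.
Qed.

(** For [y] and [z] close to [x], [z * y^-1] lies in a neighbourhood of 1 that meets [Gam] only in
    1. *)
Lemma to_quotient_locally_injective (x : G) :
  [set` Gam] `<=` isolated [set` Gam] ->
  exists2 V : set G, open V /\ V x &
    forall y z, V y -> V z -> proj y = proj z -> y = z.
Proof.
move=> disc.
have [_ [U U1 UG]] : isolated [set` Gam] 1%g.
  by apply: disc => /=; exact: gpred1.
pose f (yz : G * G) := (yz.2 * yz.1^-1)%g.
have cf : {for (x, x), continuous f}.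
  have cfst : {for (x, x), continuous (fst : G * G -> G)} by exact: cvg_fst.
  have csnd : {for (x, x), continuous (snd : G * G -> G)} by exact: cvg_snd.
  have cinv1 := continuous_comp cfst (invg_continuous lieG (x := x)).
  exact: (continuous_comp (cvg_pair csnd cinv1)
    (mulg_continuous lieG (x := (x, (x^-1)%g)))).
have : nbhs (x, x) (f @^-1` U) by apply: cf; rewrite /f /= mulgV.
move=> [[P Q] /= [Px Qx] PQ].
exists ((P `&` Q)°).
  split; first exact: open_interior.
  exact: (filterI Px Qx).
move=> y z /interior_subset[Py _] /interior_subset[_ Qz].
move=> /to_quotient_eq[g gG zE].
have : (U `&` [set` Gam]) (z * y^-1)%g.
  split; first exact: (PQ (y, z)).
  by rewrite /= zE mulgK.
rewrite UG => zy1; apply/eqP; rewrite eq_sym.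
by rewrite -(mulgVK y z) zy1 mul1g.
Qed.

(** Membership in [quotient_atlas] with the witnesses [c] and [V] kept explicit. *)
Record quotient_chart (q : chart (left_quotient Gam) 'rV[R[i]]_n)
    (c : chart G 'rV[R[i]]_n) (V : set G) : Prop := QuotientChart {
  qc_chart : A c ;
  qc_open : open V ;
  qc_sub : V `<=` cdom c ;
  qc_inj : forall x y, V x -> V y -> proj x = proj y -> x = y ;
  qc_dom : cdom q = proj @` V ;
  qc_map : forall x, V x -> cmap q (proj x) = cmap c x ;
  qc_inv : forall x, V x -> cinv q (cmap c x) = proj x }.

Lemma quotient_atlasP q :
  quotient_atlas A q <-> exists c V, quotient_chart q c V.
Proof.
split=> [[c [V [[? ? ? ?] [? ? ?]]]]|[c [V []]]]; last by exists c, V.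
by exists c, V.
Qed.

Lemma quotient_chart_image q c V : quotient_chart q c V ->
  cmap q @` cdom q = cmap c @` V.
Proof.
move=> qc; rewrite (qc_dom qc); apply/seteqP; split=> u.
  by move=> [_ [x Vx <-] <-]; rewrite (qc_map qc)//; exists x.
by move=> [x Vx <-]; exists (proj x); [exists x|rewrite (qc_map qc)].
Qed.

Lemma quotient_chart_exists c x : [set` Gam] `<=` isolated [set` Gam] ->
  A c -> cdom c x -> exists q V, quotient_chart q c V /\ V x.
Proof.
move=> disc Ac cx.
have [V [oV Vx] inj] := to_quotient_locally_injective x disc.
pose W := V `&` cdom c.
(* [pick] inverts the projection on [W]; the default [x] is taken only off the image of [W], outside
   the new chart. *)
pose pick p := xget x [set y | W y /\ proj y = p].
have pickE y : W y -> pick (proj y) = y.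
  move=> Wy; rewrite /pick; case: xgetP => [z _ [Wz zy]|/(_ y)[]//].
  by apply: inj zy; [case: Wz|case: Wy].
exists (Chart (proj @` W) (cmap c \o pick) (proj \o cinv c)), W.
split=> //; split=> //=.
- by apply: openI => //; case: (chA Ac).
- by move=> y [].
- by move=> y z [Vy _] [Vz _]; exact: inj.
- by move=> y Wy; rewrite pickE.
- by move=> y [_ cy]; rewrite (cmapK (chA Ac)).
Qed.

Lemma quotient_chart_neighbour q c V x : quotient_chart q c V -> V x ->
  \forall u \near (cmap c x : Cn), exists2 y, V y & u = cmap c y.
Proof.
move=> qc Vx.
have nV : \near x, V x.
  by apply: open_nbhs_nbhs; split=> //; exact: (qc_open qc).
apply: filterS (near_cmap (chA (qc_chart qc)) (qc_sub qc Vx) nV).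
by move=> u [y [_ Vy ->]]; exists y.
Qed.

Lemma translation_near_eq_jacobian c d g x (f : Cn -> Cn) : A c -> A d ->
  cdom c x -> cdom d (g * x)%g ->
  (\forall u \near (cmap c x : Cn),
    f u = local_rep c d (fun y => (g * y)%g) u) ->
  'J f (cmap c x) = translation_jacobian c d g x.
Proof.
move=> Ac Ad cx dx e.
have dg := translation_differentiable linv Ac Ad cx dx.
exact: (near_eq_jacobian e (near_eq_differentiableP e dg)).
Qed.

Lemma near_translate g x (V : set G) : open V -> V (g * x)%g ->
  \forall y \near x, V (g * y)%g.
Proof.
by move=> oV Vx; apply: (mulgl_continuous lieG (x := x)); exact: open_nbhs_nbhs.
Qed.

(** Translating by an element of [Gam] does not change the projection, and [q] read on [V] is [d];
    near [x] the projection is thus represented by the translation by [g]. *)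
Lemma projection_jacobian q c d V g x : quotient_chart q d V -> A c ->
  cdom c x -> V (g * x)%g -> g \in Gam ->
  'J (local_rep c q proj) (cmap c x) = translation_jacobian c d g x.
Proof.
move=> qc Ac cx Vgx gG.
apply: translation_near_eq_jacobian => //.
- exact: (qc_chart qc).
- exact: (qc_sub qc Vgx).
have nV := near_translate (qc_open qc) Vgx.
apply: filterS (near_cmap (chA Ac) cx nV) => _ [y [cy Vy ->]].
rewrite /local_rep /= (cmapK (chA Ac) cy) -(qc_map qc Vy); congr (cmap q _).
by apply/to_quotient_eq; exists g.
Qed.

(** Lifted to the group, the identity of the quotient becomes the translation by the [g] that joins
    the two lifts. *)
Lemma transition_jacobian q1 q2 c1 c2 V1 V2 g x : quotient_chart q1 c1 V1 ->
  quotient_chart q2 c2 V2 -> V1 x -> V2 (g * x)%g -> g \in Gam ->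
  'J (local_rep q1 q2 id) (cmap q1 (proj x)) = translation_jacobian c1 c2 g x.
Proof.
move=> qc1 qc2 V1x V2gx gG; rewrite (qc_map qc1 V1x).
have [Ac1 Ac2] := (qc_chart qc1, qc_chart qc2).
apply: translation_near_eq_jacobian => //.
- exact: (qc_sub qc1 V1x).
- exact: (qc_sub qc2 V2gx).
have nV : \forall y \near x, V1 y /\ V2 (g * y)%g.
  have nV2 := near_translate (qc_open qc2) V2gx.
  have nV1 : \near x, V1 x.
    by apply: open_nbhs_nbhs; split=> //; exact: (qc_open qc1).
  by apply: filterS2 nV1 nV2.
apply: filterS (near_cmap (chA Ac1) (qc_sub qc1 V1x) nV).
move=> _ [y [cy [V1y V2y] ->]].
rewrite /local_rep /= (cmapK (chA Ac1) cy) -(qc_map qc2 V2y) (qc_inv qc1 V1y).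
by congr (cmap q2 _); apply/to_quotient_eq; exists g.
Qed.

Lemma projection_jacobian_id q c V x : quotient_chart q c V -> V x ->
  'J (local_rep c q proj) (cmap c x) = 1%:M.
Proof.
move=> qc Vx; rewrite -(jacobian_id (cmap c x)).
have e : \forall u \near (cmap c x : Cn), (local_rep c q proj : Cn -> Cn) u = u.
  apply: filterS (quotient_chart_neighbour qc Vx) => _ [y Vy ->].
  rewrite /local_rep /= (cmapK (chA (qc_chart qc)) (qc_sub qc Vy)).
  exact: (qc_map qc Vy).
exact: (near_eq_jacobian e (near_eq_differentiableP e _)).
Qed.

Lemma transition_jacobian_id q c V x : quotient_chart q c V -> V x ->
  'J (local_rep q q id) (cmap q (proj x)) = 1%:M.
Proof.
move=> qc Vx; rewrite (qc_map qc Vx) -(jacobian_id (cmap c x)).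
have e : \forall u \near (cmap c x : Cn), (local_rep q q id : Cn -> Cn) u = u.
  apply: filterS (quotient_chart_neighbour qc Vx) => _ [y Vy ->].
  by rewrite /local_rep /= (qc_inv qc Vy) (qc_map qc Vy).
exact: (near_eq_jacobian e (near_eq_differentiableP e _)).
Qed.

Lemma pull_form1 k (w : blocks R n k -> R[i]) : pull_form 1%:M w = w.
Proof.
by apply/funext => B; congr w; apply/funext => i; rewrite mulmx1.
Qed.

(** * Lifting sections from the quotient *)

Section Lift.
Variables (k : nat) (s : sections R n k G).
Variable t : sections R n k (left_quotient Gam).
Hypothesis ts : pullback_eq A (quotient_atlas A) proj t s.

(** Read in [c] and [q], the projection is the identity, so the pullback leaves components
    unchanged. *)
Lemma lift_value q c V x : quotient_chart q c V -> V x -> s c x = t q (proj x).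
Proof.
move=> qc Vx; have [Ac cx] := (qc_chart qc, qc_sub qc Vx).
have Qq : quotient_atlas A q by apply/quotient_atlasP; exists c, V.
have qx : cdom q (proj x) by rewrite (qc_dom qc); exists x.
by rewrite (ts Ac Qq cx qx) (projection_jacobian_id qc Vx) pull_form1.
Qed.

Lemma lift_nonzero :
  nonzero_section (quotient_atlas A) t -> nonzero_section A s.
Proof.
move=> [q [p [B [/quotient_atlasP[c [V qc]]]]]].
rewrite (qc_dom qc) => -[x Vx <-]; rewrite -(lift_value qc Vx) => sB.
by exists c, x, B; split=> //; [exact: (qc_chart qc)|exact: (qc_sub qc Vx)].
Qed.

Lemma lift_holomorphic :
  [set` Gam] `<=` isolated [set` Gam] -> is_section A s ->
  holomorphic_section (quotient_atlas A) t -> holomorphic_section A s.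
Proof.
move=> disc hs [_ ht]; split=> // c B Ac u [x cx <-].
(* Discreteness gives a quotient chart cut out of [c] around [x], where [s] and [t] have the same
   components. *)
have [q [V [qc Vx]]] := quotient_chart_exists disc Ac cx.
have Qq : quotient_atlas A q by apply/quotient_atlasP; exists c, V.
have qu : (cmap q @` cdom q) (cmap c x).
  by rewrite (quotient_chart_image qc); exists x.
apply: near_eq_differentiableP (ht q B Qq _ qu).
apply: filterS (quotient_chart_neighbour qc Vx) => _ [y Vy ->].
by rewrite (cmapK (chA Ac) (qc_sub qc Vy)) (qc_inv qc Vy) (lift_value qc Vy).
Qed.

End Lift.

(** * Descent of invariant sections to the quotient *)

Section Descent.
Variables (k : nat) (s : sections R n k G).
Hypotheses (hs : is_section A s) (sinv : left_invariant_section A s).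

(* The chart a.1 and the point a.2 lift q and p to the group. *)
Definition lifted_point q p (a : chart G 'rV[R[i]]_n * G) : Prop :=
  exists V, [/\ quotient_chart q a.1 V, V a.2 & proj a.2 = p].

(** The value is read at an arbitrarily chosen lift; the zero form is the default when there is
    none. *)
Definition descended_section : sections R n k (left_quotient Gam) :=
  fun q p => if pselect (exists a, lifted_point q p a) is left h
    then let: (c, x) := projT1 (cid h) in s c x else fun=> 0.

(** Independence of the lift: two lifts differ by some [g] in [Gam], and the Jacobian of this
    translation is that of the transition from [q] to itself, the identity. *)
Lemma descended_sectionE q c V x : quotient_chart q c V -> V x ->
  descended_section q (proj x) = s c x.
Proof.
move=> qc Vx; rewrite /descended_section.
case: pselect => [h|[]]; last by exists (c, x), V.
case: cid => -[d y] /= [W [/= qd Wy yx]].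
have /to_quotient_eq[g gG yE] := esym yx; rewrite yE in Wy *.
have [Ac Ad] := (qc_chart qc, qc_chart qd).
rewrite (sinv Ac Ad (qc_sub qc Vx) (qc_sub qd Wy)).
rewrite -/(translation_jacobian c d g x) -(transition_jacobian qc qd Vx Wy gG).
by rewrite (transition_jacobian_id qc Vx) pull_form1.
Qed.

(** The chosen point over [proj x] is a [Gam]-translate of [x], so the claim becomes left invariance
    of [s]. *)
Lemma descended_section_pullback :
  pullback_eq A (quotient_atlas A) proj descended_section s.
Proof.
move=> c q x Ac /quotient_atlasP[d [V qd]] cx.
rewrite (qc_dom qd) => -[y Vy yx].
have /to_quotient_eq[g gG yE] := esym yx.
rewrite -yx (descended_sectionE qd Vy); rewrite yE in Vy *.
rewrite (projection_jacobian qd Ac cx Vy gG).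
exact: (sinv Ac (qc_chart qd) cx (qc_sub qd Vy)).
Qed.

Lemma descended_section_induced : induced_invariant_section A descended_section.
Proof. by exists s; split=> //; exact: descended_section_pullback. Qed.

Lemma descended_section_is_section :
  is_section (quotient_atlas A) descended_section.
Proof.
split=> [q p /quotient_atlasP[c [V qc]]|q1 q2 p].
  rewrite (qc_dom qc) => -[x Vx <-]; rewrite (descended_sectionE qc Vx).
  exact: (hs.1 _ _ (qc_chart qc) (qc_sub qc Vx)).
move=> /quotient_atlasP[c1 [V1 qc1]] /quotient_atlasP[c2 [V2 qc2]].
rewrite (qc_dom qc1) (qc_dom qc2) => -[x V1x <-] [y V2y yx].
have /to_quotient_eq[g gG yE] := esym yx.
rewrite (descended_sectionE qc1 V1x) /= -{2}yx (descended_sectionE qc2 V2y).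
rewrite yE in V2y *; rewrite (transition_jacobian qc1 qc2 V1x V2y gG).
exact: (sinv (qc_chart qc1) (qc_chart qc2) (qc_sub qc1 V1x) (qc_sub qc2 V2y)).
Qed.

Lemma descended_section_holomorphic : holomorphic_section A s ->
  holomorphic_section (quotient_atlas A) descended_section.
Proof.
move=> [_ hol]; split; first exact: descended_section_is_section.
move=> q B /quotient_atlasP[c [V qc]] u.
rewrite (quotient_chart_image qc) => -[x Vx <-].
have [Ac cx] := (qc_chart qc, qc_sub qc Vx).
have cu : (cmap c @` cdom c) (cmap c x) by exists x.
apply: near_eq_differentiableP (hol c B Ac _ cu).
apply: filterS (quotient_chart_neighbour qc Vx) => _ [y Vy ->].
rewrite (cmapK (chA Ac) (qc_sub qc Vy)) (qc_inv qc Vy).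
by rewrite (descended_sectionE qc Vy).
Qed.

Lemma descended_section_frame : frame A s ->
  frame (quotient_atlas A) descended_section.
Proof.
move=> fs q p /quotient_atlasP[c [V qc]].
rewrite (qc_dom qc) => -[x Vx <-]; rewrite (descended_sectionE qc Vx).
exact: (fs _ _ (qc_chart qc) (qc_sub qc Vx)).
Qed.

Lemma descended_section_nonzero : [set` Gam] `<=` isolated [set` Gam] ->
  nonzero_section A s -> nonzero_section (quotient_atlas A) descended_section.
Proof.
move=> disc [c [x [B [Ac cx sB]]]].
have [q [V [qc Vx]]] := quotient_chart_exists disc Ac cx.
exists q, (proj x), B; split; first by apply/quotient_atlasP; exists c, V.
  by rewrite (qc_dom qc); exists x.
by rewrite (descended_sectionE qc Vx).
Qed.

End Descent.

End Quotient.

Theorem proposition3p11 (R : realType) (n : nat) (G : topGroupType)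
    (SG : set (chart G 'rV[R]_(n + n))) (A : set (chart G 'rV[R[i]]_n)) :
  lie_group SG -> complex_structure SG A -> left_invariant_structure A ->
  ((exists (k : nat) (s : sections R n k G),
      [/\ (0 < k)%N, holomorphic_section A s,
          left_invariant_section A s & nonzero_section A s]) ->
   exists s : sections R n 1 G,
      [/\ holomorphic_section A s, left_invariant_section A s,
          nonzero_section A s & frame A s]) /\
  (forall Gam : groupClosed G, uniform_lattice Gam ->
   (exists (k : nat) (t : sections R n k (left_quotient Gam)),
      [/\ (0 < k)%N, holomorphic_section (quotient_atlas A) t,
          induced_invariant_section A t &
          nonzero_section (quotient_atlas A) t]) ->
   exists t : sections R n 1 (left_quotient Gam),
      [/\ holomorphic_section (quotient_atlas A) t,
          induced_invariant_section A t,
          nonzero_section (quotient_atlas A) t & frame (quotient_atlas A) t]).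
Proof.
move=> lieG cplx linv.
have [c0 Ac0 c01] : exists2 c, A c & cdom c 1%g.
  by case: cplx => -[[_ h] _] _; exact: h.
(* The same section, the density of [c0], serves for every [k] and [s]. *)
have main k (s : sections R n k G) : (0 < k)%N -> holomorphic_section A s ->
    left_invariant_section A s -> nonzero_section A s ->
    [/\ holomorphic_section A (density_section c0),
        left_invariant_section A (density_section c0),
        nonzero_section A (density_section c0) & frame A (density_section c0)].
  move=> k0 hs sinv snz; have is_s := hs.1; split.
  - exact: (density_section_holomorphic lieG cplx linv Ac0 c01 k0 is_s sinv
      snz hs).
  - exact: (density_section_invariant lieG cplx linv).
  - exact: (density_section_nonzero Ac0 c01 k0 is_s sinv snz).
  - exact: (density_section_frame Ac0 c01 k0 is_s sinv snz).
split=> [[k [s [k0 hs sinv snz]]]|].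
  by exists (density_section c0); exact: (main k s).
move=> Gam [disc _] [k [t [k0 ht [s [is_s sinv ts]] tnz]]].
(* The lift [s] of [t] satisfies the hypotheses on the group, and the density obtained there
   descends. *)
have hs := lift_holomorphic lieG cplx ts disc is_s ht.
have snz := lift_nonzero cplx ts tnz.
have [hd dinv dnz df] := main k s k0 hs sinv snz.
have is_d := hd.1.
exists (@descended_section _ _ _ A Gam _ (density_section c0)); split.
- exact: (descended_section_holomorphic lieG cplx linv).
- exact: (descended_section_induced lieG cplx linv).
- exact: (descended_section_nonzero lieG cplx linv).
- exact: (descended_section_frame lieG cplx linv).
Qed.
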